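(* Consider the limiting covariance matrix of the distributed system described in the context. Fix an agent $i\in[N]$ and let $\{X_n^i\}_{n\ge0}$ and $\{Y_n^i\}_{n\ge0}$ be two sampling strategies for agent $i$, with asymptotic covariance matrices $U_i^X=\Sigma_{X^i}(\nabla F_i(\theta^*,\cdot))$ and $U_i^Y=\Sigma_{Y^i}(\nabla F_i(\theta^*,\cdot))$. Let $V^X$ and $V^Y$ be the limiting covariance matrices of the system when agent $i$ employs $\{X_n^i\}$ and $\{Y_n^i\}$ respectively, while the sampling strategies of all other agents are kept unchanged. If $U_i^X\succeq U_i^Y$, then $V^X\succeq V^Y$.
   Context: Setting. $N\ge1$ agents, $[N]=\{1,\dots,N\}$. Agent $j$ has a finite data set $\mathcal X_j$ and a loss $F_j:\mathbb R^d\times\mathcal X_j\to\mathbb R$, differentiable in its first argument $\theta$ with gradient $\nabla F_j(\theta,X)$. A sampling strategy for agent $j$ is an ergodic Markov chain $\{X^j_n\}_{n\ge0}$ on $\mathcal X_j$ with stationary distribution $\pi_j$ such that $\mathbb E_{X\sim\pi_j}[F_j(\theta,X)]=f_j(\theta)$, where $f_j$ is the given expected loss of agent $j$; different agents' chains are independent. Let $f=\frac1N\sum_{j=1}^Nf_j$, twice continuously differentiable, and let $\theta^*$ be a local minimum of $f$ with $H=\nabla^2f(\theta^* )\succeq\mu I_d$, $\mu>0$. Asymptotic covariance matrix. For an ergodic Markov chain $\{X_n\}_{n\ge0}$ on a finite set with stationary distribution $\pi$ and an $\mathbb R^d$-valued function $g$ on that set, $\Sigma_X(g)=\lim_{n\to\infty}\frac1n\mathbb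 E[\Delta_n\Delta_n^T]$ with $\Delta_n=\sum_{s=0}^{n-1}(g(X_s)-\mathbb E_\pi(g))$. Limiting covariance matrix of the system. With $U_j=\Sigma_{X^j}(\nabla F_j(\theta^*,\cdot))$ for each agent $j$ and $U=\frac1{N^2}\sum_{j=1}^NU_j$, it is $$V=\int_0^\infty e^{Mt}\,U\,e^{Mt}\,dt,$$ where, for step sizes $\gamma_n=\gamma_\star/n^a$ with $a\in(0.5,1]$ and $\gamma_\star>0$ (and $\gamma_\star>1/(2\mu)$ if $a=1$), $M=-H$ if $a\in(0.5,1)$ and $M=\frac1{2\gamma_\star}I_d-H$ if $a=1$. (This is the covariance in the central limit theorem for $\gamma_n^{-1/2}(\theta_n-\theta^* )$, $\theta_n$ being the agents' average parameter in unified distributed SGD.) $A\succeq B$ denotes the Loewner order: $x^T(A-B)x\ge0$ for all $x\in\mathbb R^d$. *)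

(* Defs.v *)
From HB Require Import structures.
From mathcomp Require Import all_boot all_order all_algebra.
From mathcomp Require Import all_classical all_reals all_analysis.

Set Implicit Arguments.
Unset Strict Implicit.
Unset Printing Implicit Defensive.

Import numFieldNormedType.Exports.
Import Order.TTheory GRing.Theory Num.Theory.

Local Open Scope classical_set_scope.
Local Open Scope ring_scope.

Definition loewner_ge (R : realType) (d : nat) (A B : 'M[R]_d) : Prop :=
  forall x : 'cV[R]_d, 0 <= (x^T *m (A - B) *m x) 0 0.

Definition partial_derive (R : realType) (d : nat) (k : 'I_d)
    (h : 'cV[R]_d -> R) (theta : 'cV[R]_d) : R :=
  'D_(delta_mx k 0) h theta.

Definition grad (R : realType) (d : nat) (h : 'cV[R]_d -> R)
    (theta : 'cV[R]_d) : 'cV[R]_d :=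
  \col_k partial_derive k h theta.

Definition hess (R : realType) (d : nat) (h : 'cV[R]_d -> R)
    (theta : 'cV[R]_d) : 'M[R]_d :=
  \matrix_(k, l) partial_derive k (partial_derive l h) theta.

Definition twice_continuously_differentiable (R : realType) (d : nat)
    (h : 'cV[R]_d -> R) : Prop :=
  [/\ forall theta, differentiable h theta,
      forall l theta, differentiable (partial_derive l h) theta &
      forall k l, continuous (partial_derive k (partial_derive l h))].

Definition local_minimum (R : realType) (d : nat) (h : 'cV[R]_d -> R)
    (theta : 'cV[R]_d) : Prop :=
  \forall t \near theta, h theta <= h t.

Definition expmx (R : realType) (d : nat) (A : 'M[R]_d) : 'M[R]_d :=
  limn (series (fun k : nat => (k`!%:R)^-1 *: A ^+ k)).

Definition distribution_on (R : realType) (S : finType) (pi : S -> R) : Prop :=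
  (forall x, 0 <= pi x) /\ \sum_x pi x = 1.

Definition stochastic (R : realType) (S : finType) (Q : S -> S -> R) : Prop :=
  forall x, distribution_on (Q x).

Definition stationary (R : realType) (S : finType) (Q : S -> S -> R)
    (pi : S -> R) : Prop :=
  distribution_on pi /\ forall y, \sum_x pi x * Q x y = pi y.

Fixpoint kernel_pow (R : realType) (S : finType) (Q : S -> S -> R) (n : nat)
    (x y : S) : R :=
  if n is m.+1 then \sum_z Q x z * kernel_pow Q m z y else (x == y)%:R.

Definition irreducible_kernel (R : realType) (S : finType) (Q : S -> S -> R)
    : Prop :=
  forall x y, exists n, 0 < kernel_pow Q n x y.

(* The return times to each state have greatest common divisor 1. *)
Definition aperiodic (R : realType) (S : finType) (Q : S -> S -> R) : Prop :=
  forall x (m : nat),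
    (forall n, (0 < n)%N -> 0 < kernel_pow Q n x x -> (m %| n)%N) -> m = 1%N.

Definition ergodic (R : realType) (S : finType) (Q : S -> S -> R) : Prop :=
  irreducible_kernel Q /\ aperiodic Q.

Definition path_event (Omega : Type) (S : finType) (X : nat -> Omega -> S)
    (x : nat -> S) (n : nat) : set Omega :=
  [set w | forall s, (s < n)%N -> X s w = x s].

(* The law of X_0 is arbitrary; finite state spaces carry the discrete
   sigma-algebra, so each X n is a random variable iff its fibres are
   measurable. The Markov property is stated on joint probabilities, which
   avoids conditioning on null events. *)
Definition markov_chain (R : realType) (disp : measure_display)
    (Omega : measurableType disp) (P : probability Omega R) (S : finType)
    (Q : S -> S -> R) (X : nat -> Omega -> S) : Prop :=
  [/\ stochastic Q,
      forall n x, measurable [set w | X n w = x] &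
      forall (x : nat -> S) n,
        P (path_event X x n.+2) =
        (P (path_event X x n.+1) * (Q (x n) (x n.+1))%:E)%E].

Record sampling_strategy (R : realType) (disp : measure_display)
    (Omega : measurableType disp) (P : probability Omega R) (d : nat)
    (S : finType) (F : 'cV[R]_d -> S -> R) (f : 'cV[R]_d -> R) :=
  SamplingStrategy {
    chain : nat -> Omega -> S;
    kernel : S -> S -> R;
    stat : S -> R;
    chain_markov : markov_chain P kernel chain;
    kernel_ergodic : ergodic kernel;
    stat_stationary : stationary kernel stat;
    stat_unbiased : forall theta, \sum_x stat x * F theta x = f theta }.

(* Mutual independence of the whole processes; as the state spaces are finite,
   the path events up to a common horizon n suffice. *)
Definition independent_chains (R : realType) (disp : measure_display)
    (Omega : measurableType disp) (P : probability Omega R) (N : nat)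
    (S : 'I_N -> finType) (X : forall j, nat -> Omega -> S j) : Prop :=
  forall (x : forall j, nat -> S j) (n : nat),
    P [set w | forall j, path_event (X j) (x j) n w] =
    (\prod_(j < N) P (path_event (X j) (x j) n))%E.

Definition centered_sum (R : realType) (Omega : Type) (S : finType) (d : nat)
    (pi : S -> R) (X : nat -> Omega -> S) (g : S -> 'cV[R]_d) (n : nat)
    (w : Omega) : 'cV[R]_d :=
  \sum_(s < n) (g (X s w) - \sum_x pi x *: g x).

Definition asymptotic_cov (R : realType) (disp : measure_display)
    (Omega : measurableType disp) (P : probability Omega R) (S : finType)
    (d : nat) (pi : S -> R) (X : nat -> Omega -> S) (g : S -> 'cV[R]_d)
    : 'M[R]_d :=
  limn (fun n : nat => n%:R^-1 *:
    \matrix_(k, l) fine 'E_P[fun w =>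
      (centered_sum pi X g n w *m (centered_sum pi X g n w)^T) k l]%E).

Definition strategy_cov (R : realType) (disp : measure_display)
    (Omega : measurableType disp) (P : probability Omega R) (d : nat)
    (S : finType) (F : 'cV[R]_d -> S -> R) (f : 'cV[R]_d -> R)
    (theta : 'cV[R]_d) (X : sampling_strategy P F f) : 'M[R]_d :=
  asymptotic_cov P (stat X) (chain X) (fun x => grad (F^~ x) theta).

Definition avg_loss (R : realType) (d N : nat) (f : 'I_N -> 'cV[R]_d -> R)
    (theta : 'cV[R]_d) : R :=
  N%:R^-1 * \sum_(j < N) f j theta.

Definition drift_mx (R : realType) (d : nat) (a gstar : R) (H : 'M[R]_d)
    : 'M[R]_d :=
  if a == 1 then ((2 * gstar)^-1)%:M - H else - H.

Definition limiting_cov (R : realType) (d : nat) (M U : 'M[R]_d) : 'M[R]_d :=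
  \matrix_(k, l) \int[lebesgue_measure]_(t in `[0, +oo[)
    ((expmx (t *: M) *m U *m expmx (t *: M)) k l).

Definition system_cov (R : realType) (disp : measure_display)
    (Omega : measurableType disp) (P : probability Omega R) (d N : nat)
    (S : 'I_N -> finType) (F : forall j, 'cV[R]_d -> S j -> R)
    (f : 'I_N -> 'cV[R]_d -> R) (a gstar : R) (theta : 'cV[R]_d)
    (X : forall j, sampling_strategy P (F j) (f j)) : 'M[R]_d :=
  limiting_cov (drift_mx a gstar (hess (avg_loss f) theta))
    ((N%:R ^+ 2)^-1 *: \sum_(j < N) strategy_cov theta (X j)).

(* Main.v *)
Require Import Defs.
From HB Require Import structures.
From mathcomp Require Import all_boot all_order all_algebra.
From mathcomp Require Import all_classical all_reals all_analysis.
From mathcomp Require Import measurable_realfun ring lra.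

Set Implicit Arguments.
Unset Strict Implicit.
Unset Printing Implicit Defensive.

Import numFieldNormedType.Exports.
Import Order.TTheory GRing.Theory Num.Theory.

Local Open Scope classical_set_scope.
Local Open Scope ring_scope.

(** [V^X - V^Y] is the integral over [t >= 0] of [e^(Mt) D e^(Mt)], where
    [D = (U_i^X - U_i^Y) / N^2]. The Hessian is symmetric by Schwarz's theorem,
    hence so is [e^(Mt)], and [x^T e^(Mt) D e^(Mt) x = y^T D y >= 0] with
    [y = e^(Mt) x]. Splitting the integral needs integrability: since
    [- M >= m I] with [m > 0], the squared Frobenius norm of [e^(Mt)] times
    [e^(2mt)] is nonincreasing, so the integrand decays exponentially. *)

(** * Schwarz's theorem for mixed directional derivatives *)

Section mixed_derivatives.
Context {R : realType} {V : normedModType R}.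
Implicit Types (g h : V -> R) (x v w : V) (t : R).

Lemma is_derive_line g x v t : derivable g (x + t *: v) v ->
  is_derive t 1 (fun s => g (x + s *: v)) ('D_v g (x + t *: v)).
Proof.
move=> dg.
(* The one-variable quotient at [t] and the directional quotient at [x + t *: v] are the same
   function of [r], so derivability and value both transfer. *)
have E : (fun r : R => r^-1 *: (g (x + (r *: 1 + t) *: v) - g (x + t *: v))) =
    (fun r => r^-1 *: (g (r *: v + (x + t *: v)) - g (x + t *: v))).
  by apply/funext => r; rewrite scalerDl [r *: 1]mulr1 addrCA.
apply: DeriveDef.
  by rewrite /derivable/= E; exact: dg.
by rewrite /derive/= E.
Qed.

Lemma MVT_line g x v t : (forall y, derivable g y v) -> 0 < t ->
  exists2 s, 0 < s < t & g (x + t *: v) - g x = 'D_v g (x + s *: v) * t.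
Proof.
move=> dg t0.
have [||s] := @MVT R (fun s => g (x + s *: v))
  (fun s => 'D_v g (x + s *: v)) _ _ t0.
- by move=> s _; exact: is_derive_line.
- apply: continuous_subspaceT => s.
  apply/differentiable_continuous/derivable1_diffP.
  by have [] := is_derive_line (dg (x + s *: v)).
- by rewrite in_itv/= => st; rewrite scale0r addr0 subr0 => ->; exists s.
Qed.

(** The second difference is the increment of [z |-> h (z + t *: w) - h z] along [v]. The mean value
    theorem along [v] produces [a]; applied to ['D_v h] along [w], it then produces [b]. *)
Lemma second_difference h x v w t :
  (forall y, derivable h y v) -> (forall y, derivable ('D_v h) y w) -> 0 < t ->
  exists a b, [/\ 0 < a < t, 0 < b < t &
    h (x + t *: v + t *: w) - h (x + t *: v) - h (x + t *: w) + h x =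
    'D_w ('D_v h) (x + a *: v + b *: w) * t ^+ 2].
Proof.
move=> dh ddh t0.
have dsh y : is_derive y v (fun z => h (z + t *: w)) ('D_v h (y + t *: w)).
  have E : (fun k : R => k^-1 *: (h (k *: v + y + t *: w) - h (y + t *: w))) =
      (fun k => k^-1 *: (h (k *: v + (y + t *: w)) - h (y + t *: w))).
    by apply/funext => s; rewrite addrA.
  by apply: DeriveDef; rewrite /derivable /derive /= E //; exact: dh.
have dg y : is_derive y v (fun z => h (z + t *: w) - h z)
    ('D_v h (y + t *: w) - 'D_v h y).
  by apply: is_deriveB; apply/derivableP.
have [a at0 ga] := MVT_line x (fun y => @ex_derive _ _ _ _ _ _ _ (dg y)) t0.
have [b bt0 gb] := MVT_line (x + a *: v) ddh t0.
exists a, b; split => //.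
rewrite expr2 mulrA -gb.
move: ga; rewrite (@derive_val _ _ _ _ _ _ _ (dg _)) => <-.
by rewrite opprB addrA addrAC.
Qed.

(** The second difference is symmetric in [v] and [w], so the two mixed derivatives take a common
    value at two points arbitrarily close to [x]; continuity at [x] then identifies them there. *)
Lemma derive_comm h x v w :
  (forall y, derivable h y v) -> (forall y, derivable h y w) ->
  (forall y, derivable ('D_v h) y w) -> (forall y, derivable ('D_w h) y v) ->
  {for x, continuous ('D_w ('D_v h))} -> {for x, continuous ('D_v ('D_w h))} ->
  'D_w ('D_v h) x = 'D_v ('D_w h) x.
Proof.
move=> dv dw dvw dwv cvw cwv.
apply/eqP; rewrite -subr_eq0 -normr_le0; apply/ler_addgt0Pr => e e0.
rewrite add0r.
have e20 : 0 < e / 2 by rewrite divr_gt0.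
have /cvgrPdist_lt/(_ _ e20) := cvw; have /cvgrPdist_lt/(_ _ e20) := cwv.
move=> near1 near2; have [r /= r0 near12] :=
  (@nbhs_ballP R V x _).1 (filterI near1 near2).
(* With this [t], steps [a, b < t] move [x] by at most [t * (|v| + |w|) < r]; the [+ 1] keeps the
   denominator positive when both directions vanish. *)
pose t := r / (`|v| + `|w| + 1).
have n0 : 0 < `|v| + `|w| + 1 by rewrite ltr_wpDl// addr_ge0.
have t0 : 0 < t by rewrite divr_gt0.
have inball a b : 0 < a < t -> 0 < b < t -> ball x r (x + a *: v + b *: w).
  move=> /andP[a0 at0] /andP[b0 bt0]; rewrite -addrA -ball_normE/=.
  rewrite opprD addNKr normrN.
  apply: le_lt_trans (ler_normD _ _) _; rewrite !normrZ !gtr0_norm//.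
  apply: (@le_lt_trans _ _ (t * (`|v| + `|w|))).
    by rewrite mulrDr lerD// ler_wpM2r// ltW.
  by rewrite /t mulrAC ltr_pdivrMr// ltr_pM2l// ltrDl.
have [a [b [at0 bt0 E1]]] := second_difference x dv dvw t0.
have [a' [b' [at0' bt0' E2]]] := second_difference x dw dwv t0.
(* Both sides times [t ^+ 2] are the same second difference, read in the two orders. *)
have {E2}E : 'D_w ('D_v h) (x + a *: v + b *: w) =
    'D_v ('D_w h) (x + b' *: v + a' *: w).
  have t2 : t ^+ 2 != 0 by rewrite expf_neq0// gt_eqF.
  apply: (mulIf t2); rewrite [x + b' *: v + _]addrAC; apply: etrans (esym E1) _.
  apply: etrans E2; rewrite [x + t *: v + _]addrAC.
  by rewrite [_ - h (x + t *: v) - _]addrAC.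
have [_ N1] := near12 _ (inball _ _ at0 bt0).
have [N2 _] := near12 _ (inball _ _ bt0' at0').
rewrite [e]splitr; apply: le_trans (ltW (ltrD N1 N2)).
rewrite /= in E *; rewrite E [X in _ <= _ + X]distrC.
apply: le_trans (ler_normD _ _).
by rewrite addrA subrK.
Qed.

End mixed_derivatives.

Lemma hess_sym (R : realType) (d : nat) (h : 'cV[R]_d -> R) (theta : 'cV[R]_d) :
  twice_continuously_differentiable h -> (hess h theta)^T = hess h theta.
Proof.
move=> [dh ddh cddh]; apply/matrixP => k l; rewrite !mxE.
apply: derive_comm => [y|y|y|y||].
- exact/diff_derivable/dh.
- exact/diff_derivable/dh.
- exact/diff_derivable/ddh.
- exact/diff_derivable/ddh.
- exact: cddh.
- exact: cddh.
Qed.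

(** * The matrix exponential: entries as power series, derivative, symmetry, decay *)

Lemma cvg_mx (R : realType) (m n : nat) (u : nat -> 'M[R]_(m, n))
    (A : 'M[R]_(m, n)) :
  (forall i j, u k i j @[k --> \oo] --> A i j) -> u @ \oo --> A.
Proof.
move=> uA B [P AP PB]; rewrite nbhs_simpl/=.
suff : \forall k \near \oo, forall i j, P i j (u k i j).
  by apply: filterS => k; exact: PB.
by apply: filter_forall => i; apply: filter_forall => j; exact: uA (AP i j).
Qed.

Section matrix_exponential.
Context {R : realType} {d : nat}.
Variable M : 'M[R]_d.

Let c (k l : 'I_d) (n : nat) : R := (n`!%:R)^-1 * (M ^+ n) k l.

Let normM : R := \sum_i \sum_j `|M i j|.

(** Each further factor [M] costs at most the absolute sum of one row, which [normM] dominates. The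
    entry series are thereby compared with the exponential series at [normM * |x|]. *)
Let entry_expr_le n k l : `|(M ^+ n) k l| <= normM ^+ n.
Proof.
elim: n k l => [|n IHn] k l.
  by rewrite !expr0 mxE normr_nat lern1 leq_b1.
rewrite !exprS -mulmxE mxE.
apply: le_trans (ler_norm_sum _ _ _) _.
apply: (@le_trans _ _ ((\sum_j `|M k j|) * normM ^+ n)).
  by rewrite mulr_suml ler_sum// => j _; rewrite normrM ler_wpM2l.
apply: ler_wpM2r.
  by apply: exprn_ge0; rewrite !sumr_ge0// => i _; rewrite sumr_ge0.
by rewrite /normM [leRHS](bigD1 k)//= lerDl sumr_ge0// => i _; rewrite sumr_ge0.
Qed.

Let is_cvg_pseries_entry k l (x : R) : cvgn (pseries (c k l) x).
Proof.
apply: normed_cvg.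
apply: series_le_cvg (is_cvg_series_exp_coeff (normM * `|x|)) => n //=.
  apply: exp_coeff_ge0; rewrite mulr_ge0// sumr_ge0// => i _; exact: sumr_ge0.
rewrite /exp_coeff/= exprMn !normrM normrX ger0_norm ?invr_ge0//.
rewrite -mulrA [leRHS]mulrC ler_wpM2l ?invr_ge0//.
by rewrite ler_wpM2r ?exprn_ge0.
Qed.

(** Reduces the matrix limit to scalar power series in [t], to which termwise differentiation
    applies. *)
Lemma expmx_entry (t : R) k l : expmx (t *: M) k l = limn (pseries (c k l) t).
Proof.
have cv : series (fun n => (n`!%:R)^-1 *: (t *: M) ^+ n) @ \oo -->
    \matrix_(i, j) limn (pseries (c i j) t).
  apply: cvg_mx => i j; rewrite mxE.
  rewrite (_ : (fun k => _) = pseries (c i j) t).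
    exact: is_cvg_pseries_entry.
  have exprZ n : (t *: M) ^+ n = t ^+ n *: M ^+ n.
    elim: n => [|n IHn]; first by rewrite !expr0 scale1r.
    by rewrite !exprS IHn -!mulmxE -scalemxAl -scalemxAr scalerA.
  apply/funext => n; rewrite /pseries /series /= summxE.
  apply: eq_bigr => m _; rewrite exprZ scalerA !mxE /c; ring.
by rewrite /expmx (cvg_lim _ cv) ?mxE//; exact: norm_hausdorff.
Qed.

Let pseries_diffs_entry k l :
  pseries_diffs (c k l) = fun n => \sum_m M k m * c m l n.
Proof.
apply/funext => n; rewrite /pseries_diffs /c exprS -mulmxE mxE.
rewrite !mulr_sumr; apply: eq_bigr => m _.
rewrite factS natrM invfM !mulrA divff ?pnatr_eq0// mul1r; ring.
Qed.

Let cvg_pseries_sum (b : 'I_d -> R) (e : 'I_d -> nat -> R) x :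
  (forall m, cvgn (pseries (e m) x)) ->
  pseries (fun n => \sum_m b m * e m n) x @ \oo -->
    \sum_m b m * limn (pseries (e m) x).
Proof.
move=> ce.
rewrite (_ : pseries _ x = fun n => \sum_m b m * pseries (e m) x n).
  apply: cvg_big => [|m _]; first exact: add_continuous.
  by apply: cvgM (ce m); exact: cvg_cst.
apply/funext => n; rewrite /pseries /series/=.
under [RHS]eq_bigr do rewrite mulr_sumr.
rewrite exchange_big/=; apply: eq_bigr => i _; rewrite mulr_suml.
by apply: eq_bigr => m _; rewrite mulrA.
Qed.

(** Formal differentiation sends the coefficient [M^n / n!] to [M * (M^n / n!)], so every formal
    derivative is a finite combination of entry series and converges everywhere. *)
Lemma is_derive_expmx (t : R) k l :
  is_derive t 1 (fun s => expmx (s *: M) k l)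
    (\sum_m M k m * expmx (t *: M) m l).
Proof.
have cvg1 m x : cvgn (pseries (pseries_diffs (c m l)) x).
  rewrite pseries_diffs_entry; apply/cvg_ex; eexists; exact: cvg_pseries_sum.
have E2 : pseries_diffs (pseries_diffs (c k l)) =
    fun n => \sum_m M k m * pseries_diffs (c m l) n.
  rewrite {1}pseries_diffs_entry; apply/funext => n; rewrite /pseries_diffs.
  by rewrite mulr_sumr; apply: eq_bigr => m _; ring.
under eq_fun do rewrite expmx_entry; under eq_bigr do rewrite expmx_entry.
have <- : limn (pseries (pseries_diffs (c k l)) t) =
    \sum_m M k m * limn (pseries (c m l) t).
  rewrite pseries_diffs_entry; apply: cvg_lim => //; exact: cvg_pseries_sum.
(* Termwise differentiation at [t] needs the series and its first two formal derivatives to converge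
   at a point of modulus larger than [|t|]. *)
apply: (@pseries_snd_diffs _ _ (`|t| + 1)) => //.
  rewrite E2; apply/cvg_ex; eexists; exact: cvg_pseries_sum.
by rewrite [ltRHS]ger0_norm// ltrDl.
Qed.

Lemma continuous_expmx k l : continuous (fun s : R => expmx (s *: M) k l).
Proof.
move=> t; apply/differentiable_continuous/derivable1_diffP.
by have [] := is_derive_expmx t k l.
Qed.

Lemma expmx_sym (t : R) : M^T = M -> (expmx (t *: M))^T = expmx (t *: M).
Proof.
move=> Msym; apply/matrixP => k l; rewrite mxE !expmx_entry.
congr (limn (pseries _ t)); apply/funext => n; rewrite /c; congr (_ * _).
suff E : M ^+ n = (M ^+ n)^T by rewrite {1}E mxE.
elim: n => [|n IHn]; first by rewrite expr0 trmx1.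
by rewrite {2}exprSr -mulmxE trmx_mul Msym -IHn exprS.
Qed.

Lemma expmx_decay (m : R) : loewner_ge (- M) m%:M ->
  exists C : R, forall t k l, 0 <= t ->
    expmx (t *: M) k l ^+ 2 <= C * expR (- (2 * m) * t).
Proof.
move=> Mm.
pose phi (t : R) := \sum_k \sum_l expmx (t *: M) k l ^+ 2.
pose dphi (t : R) := \sum_k \sum_l
  2 * (expmx (t *: M) k l * \sum_j M k j * expmx (t *: M) j l).
have dphiP (t : R) : is_derive t 1 phi (dphi t).
  rewrite /phi (_ : (fun s => _) =
      \sum_k \sum_l (fun s : R => expmx (s *: M) k l) ^+ 2); last first.
    apply/funext => s; rewrite fct_sumE; apply: eq_bigr => k _.
    by rewrite fct_sumE.
  apply: is_derive_sum => k; apply: is_derive_sum => l.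
  apply: is_derive_eq.
    by apply: is_deriveX; exact: is_derive_expmx.
  by rewrite expr1 -[LHS]/(_ * _) -mulrA.
(* The squared Frobenius norm is split into columns of the exponential, and the Loewner bound is
   applied to each column. *)
have dphi_le (t : R) : dphi t + 2 * m * phi t <= 0.
  suff -> : dphi t + 2 * m * phi t = - (2 * \sum_l
      ((col l (expmx (t *: M)))^T *m (- M - m%:M) *m col l (expmx (t *: M))) 0 0).
    by rewrite oppr_le0 mulr_ge0// sumr_ge0// => l _; exact: Mm.
  rewrite /dphi /phi exchange_big/= [X in 2 * m * X]exchange_big/=.
  rewrite -mulrA mulr_sumr mulr_sumr -big_split/= mulr_sumr -sumrN.
  apply: eq_bigr => l _.
  rewrite -opprD mulmxN mulNmx mulmxDr mulmxDl mul_mx_scalar -scalemxAl -mulmxA.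
  rewrite -mulr_sumr !mxE -mulrDr mulrN opprK; congr (2 * (_ + _ * _)).
    apply: eq_bigr => k _; rewrite !mxE; congr (_ * _).
    by apply: eq_bigr => j _; rewrite !mxE.
  by apply: eq_bigr => k _; rewrite !mxE expr2.
pose g (t : R) := phi t * expR (2 * m * t).
have dg (t : R) : is_derive t 1 g ((dphi t + 2 * m * phi t) * expR (2 * m * t)).
  have de : is_derive t (1 : R) (fun s : R => expR (2 * m * s))
      (2 * m * expR (2 * m * t)).
    have dl : is_derive t (1 : R) (fun s : R => 2 * m * s) (2 * m).
      have := is_deriveZ (2 * m) (is_derive_id t (1 : R)).
      by rewrite [_ *: 1]mulr1.
    rewrite [2 * m * expR _]mulrC.
    exact: (is_derive1_comp (is_derive_expR _) dl).
  apply: is_derive_eq (is_deriveM (dphiP t) de) _.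
  rewrite -[LHS]/(phi t * _ + expR _ * _).
  ring.
have g_le t : 0 <= t -> g t <= g 0.
  move=> t0; apply: (@ler0_derive1_nincry _ g 0) => //.
  - move=> s _; rewrite derive1E (@derive_val _ _ _ _ _ _ _ (dg s)).
    by rewrite mulr_le0_ge0// expR_ge0.
  - apply: continuous_subspaceT => s.
    by apply/differentiable_continuous/derivable1_diffP; have [] := dg s.
(* The constant is the initial value of the nonincreasing [g]; a single squared entry is at most
   [phi t]. *)
exists (g 0) => t k l t0.
rewrite mulNr expRN ler_pdivlMr ?expR_gt0//; apply: le_trans (g_le t t0).
rewrite /g ler_wpM2r ?expR_ge0//.
rewrite /phi (bigD1 k)//= (bigD1 l)//= -addrA lerDl.
apply: addr_ge0; apply: sumr_ge0 => j _; first exact: sqr_ge0.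
by apply: sumr_ge0 => j' _; exact: sqr_ge0.
Qed.

End matrix_exponential.

(** * Integrability, linearity and monotonicity of the limiting covariance *)

Lemma Rintegral_sum (R : realType) (disp : measure_display)
    (T : measurableType disp) (mu : {measure set T -> \bar R}) (D : set T)
    (I : Type) (s : seq I) (f : I -> T -> R) :
  measurable D -> (forall i, mu.-integrable D (EFin \o f i)) ->
  \int[mu]_(t in D) (\sum_(i <- s) f i t) =
  \sum_(i <- s) \int[mu]_(t in D) f i t.
Proof.
move=> mD fi; elim: s => [|i s IHs].
  under eq_Rintegral do rewrite big_nil.
  by rewrite big_nil Rintegral_cst// mul0r.
under eq_Rintegral do rewrite big_cons.
rewrite big_cons RintegralD ?IHs//.
rewrite (_ : _ \o _ = fun t => (\sum_(j <- s) (EFin \o f j) t)%E).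
  exact: integrable_sum.
by apply/funext => t /=; rewrite sumEFin.
Qed.

Section limiting_covariance.
Context {R : realType} {d : nat}.
Variables (M : 'M[R]_d) (m : R).
Hypotheses (m_gt0 : 0 < m) (Mm : loewner_ge (- M) m%:M).

Let mu := @lebesgue_measure R.

Lemma integrable_expmx_sandwich (U : 'M[R]_d) k l :
  mu.-integrable `[0, +oo[
    (EFin \o (fun t : R => (expmx (t *: M) *m U *m expmx (t *: M)) k l)).
Proof.
have mD : measurable (`[0, +oo[ : set (measurableTypeR R)).
  exact: measurable_itv.
have [C EC] := expmx_decay Mm.
(* The dominating function is a rescaled exponential density of rate [2 * m]. *)
have intexp : mu.-integrable `[0, +oo[
    (EFin \o (fun t : R => expR (- (2 * m) * t))).
  have m20 : 0 < 2 * m by rewrite mulr_gt0.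
  have := integrableZl mD (2 * m)^-1
    (integrableS measurableT mD (@subsetT _ _)
      (integrable_exponential_pdf m20)).
  apply: eq_integrable => // t; rewrite inE/= in_itv/= andbT => t0.
  by rewrite exponential_pdfE// -EFinM mulKf ?gt_eqF.
rewrite (_ : _ \o _ = fun t : R => (\sum_q \sum_p
    ((U p q)%:E * (expmx (t *: M) k p * expmx (t *: M) q l)%:E))%E).
  apply: integrable_sum => [//|q _].
  apply: integrable_sum => [//|p _].
  apply: integrableZl => //.
  apply: (le_integrable mD _ _ (integrableZl mD C intexp)).
  - apply/measurable_EFinP/measurable_funTS/measurable_funM;
      by apply: continuous_measurable_fun; exact: continuous_expmx.
  (* The product of two entries is bounded by [y * z <= (y^2 + z^2) / 2], each square being at most
     [C * expR (- (2 * m) * t)]. *)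
  - move=> t /=; rewrite in_itv/= andbT => t0.
    rewrite lee_fin; apply: le_trans (ler_norm _); rewrite normrM.
    have := EC t k p t0; have := EC t q l t0.
    have := real_normK (num_real (expmx (t *: M) k p)) => <-.
    have := real_normK (num_real (expmx (t *: M) q l)) => <-.
    move: (C * _) `|expmx _ k p| `|expmx _ q l| => c y z; nra.
apply/funext => t /=; rewrite !mxE -sumEFin; apply: eq_bigr => q _.
rewrite !mxE mulr_suml -sumEFin; apply: eq_bigr => p _.
by rewrite -EFinM; congr (_%:E); ring.
Qed.

Lemma limiting_covB (U W : 'M[R]_d) :
  limiting_cov M U - limiting_cov M W = limiting_cov M (U - W).
Proof.
apply/matrixP => k l; rewrite !mxE -RintegralB; last 3 first.
- exact: measurable_itv.
- exact: integrable_expmx_sandwich.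
- exact: integrable_expmx_sandwich.
by apply: eq_Rintegral => t _; rewrite mulmxBr mulmxBl !mxE.
Qed.

(** The matrix integral is taken entry by entry, so positivity of the integrand as a quadratic form
    is usable only after the form, a finite combination of integrable entries, is moved under the
    integral. *)
Lemma limiting_cov_quad (U : 'M[R]_d) (x : 'cV[R]_d) :
  (x^T *m limiting_cov M U *m x) 0 0 =
  \int[mu]_(t in `[0, +oo[)
    (x^T *m (expmx (t *: M) *m U *m expmx (t *: M)) *m x) 0 0.
Proof.
have mD : measurable (`[0, +oo[ : set (measurableTypeR R)).
  exact: measurable_itv.
have quadE (A : 'M[R]_d) :
    (x^T *m A *m x) 0 0 = \sum_l \sum_k x k 0 * x l 0 * A k l.
  rewrite mxE; apply: eq_bigr => l _; rewrite mxE mulr_suml.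
  by apply: eq_bigr => k _; rewrite mxE; ring.
have intk l k : mu.-integrable `[0, +oo[ (EFin \o (fun t : R =>
    x k 0 * x l 0 * (expmx (t *: M) *m U *m expmx (t *: M)) k l)).
  exact: (integrableZl mD _ (integrable_expmx_sandwich U k l)).
rewrite quadE; under eq_Rintegral do rewrite quadE.
rewrite Rintegral_sum//; last first.
  move=> l; rewrite (_ : _ \o _ = fun t : R => (\sum_k
      (x k 0%R * x l 0%R * (expmx (t *: M) *m U *m expmx (t *: M)) k l)%:E)%E).
    by apply: integrable_sum => // k _; exact: intk.
  by apply/funext => t /=; rewrite sumEFin.
apply: eq_bigr => l _; rewrite Rintegral_sum//; apply: eq_bigr => k _.
by rewrite mxE RintegralZl//; exact: integrable_expmx_sandwich.
Qed.

Lemma limiting_cov_mono (U W : 'M[R]_d) : M^T = M ->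
  loewner_ge U W -> loewner_ge (limiting_cov M U) (limiting_cov M W).
Proof.
move=> Msym UW x; rewrite limiting_covB limiting_cov_quad.
apply: Rintegral_ge0 => t _.
have := UW (expmx (t *: M) *m x).
by rewrite trmx_mul expmx_sym// !mulmxA.
Qed.

End limiting_covariance.

(** * Replacing the strategy of one agent, and the comparison of the two systems *)

Lemma sum_dfwithB (I : finType) (T : I -> Type) (V : zmodType)
    (c : forall j, T j -> V) (X : forall j, T j) (i : I) (y : T i) :
  \sum_j c j (X j) - \sum_j c j (dfwith X i y j) = c i (X i) - c i y.
Proof.
rewrite (bigD1 i)//= [X in _ - X](bigD1 i)//= dfwithin.
rewrite [X in _ - (_ + X)](eq_bigr (fun j => c j (X j))).
  by rewrite opprD addrACA subrr addr0.
by move=> j ji; rewrite dfwithout// eq_sym.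
Qed.

Theorem corollary3p4 (R : realType) (disp : measure_display)
    (Omega : measurableType disp) (P : probability Omega R)
    (d N : nat) (S : 'I_N -> finType)
    (F : forall j : 'I_N, 'cV[R]_d -> S j -> R)
    (f : 'I_N -> 'cV[R]_d -> R)
    (thetastar : 'cV[R]_d) (mu a gstar : R)
    (F_diff : forall (j : 'I_N) (x : S j) (theta : 'cV[R]_d),
       differentiable ((F j)^~ x) theta)
    (f_C2 : twice_continuously_differentiable (avg_loss f))
    (f_min : local_minimum (avg_loss f) thetastar)
    (mu_gt0 : 0 < mu)
    (hess_ge : loewner_ge (hess (avg_loss f) thetastar) mu%:M)
    (a_gt : 1 / 2 < a) (a_le1 : a <= 1)
    (gstar_gt0 : 0 < gstar)
    (gstar_gt : a = 1 -> 1 / (2 * mu) < gstar)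
    (i : 'I_N)
    (X : forall j : 'I_N, sampling_strategy P (F j) (f j))
    (Yi : sampling_strategy P (F i) (f i))
    (X_indep : independent_chains P (fun j => chain (X j)))
    (Y_indep : independent_chains P (fun j => chain (dfwith X i Yi j))) :
  loewner_ge (strategy_cov thetastar (X i)) (strategy_cov thetastar Yi) ->
  loewner_ge (system_cov a gstar thetastar X)
             (system_cov a gstar thetastar (dfwith X i Yi)).
Proof.
move=> XY.
set H := hess (avg_loss f) thetastar.
have Hsym : H^T = H by exact: hess_sym.
have [m m_gt0 Mm] : exists2 m, 0 < m & loewner_ge (- drift_mx a gstar H) m%:M.
  rewrite /drift_mx; case: eqP => [a1|_]; last by exists mu; rewrite ?opprK.
  (* For [a = 1] the shift of the drift lowers the decay rate from [mu] by [1 / (2 * gstar)];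
     [gstar_gt] says exactly that the remainder is positive. *)
  exists (mu - (2 * gstar)^-1).
    have := gstar_gt a1; rewrite subr_gt0 ltr_pdivrMr ?mulr_gt0// => ?.
    by rewrite -div1r ltr_pdivrMr ?mulr_gt0//; lra.
  move=> x; have := hess_ge x; rewrite -/H.
  by rewrite [(mu - _)%:M]raddfB/= !opprB addrA subrK.
apply: (limiting_cov_mono m_gt0 Mm).
  rewrite /drift_mx; case: ifP => _.
    by rewrite linearB/= tr_scalar_mx Hsym.
  by rewrite linearN/= Hsym.
(* The averaged covariances differ by a nonnegative multiple of the difference for agent [i], since
   all other summands cancel. *)
move=> x; rewrite -scalerBr -scalemxAr -scalemxAl mxE.
rewrite mulr_ge0 ?invr_ge0 ?exprn_ge0//.
rewrite (sum_dfwithB (fun j (Z : sampling_strategy P (F j) (f j)) =>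
  strategy_cov thetastar Z)).
exact: XY.
Qed.
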